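(* Let $\mathbf{y}\in\mathbb{R}^n$ and $\boldsymbol{\Phi}\in\mathbb{R}^{n\times d}$, and let $\boldsymbol{\Sigma}=\frac1n\boldsymbol{\Phi}^\top\boldsymbol{\Phi}$, $\mathrm{MSD}(\boldsymbol{\theta})=\frac1n\|\mathbf{y}-\boldsymbol{\Phi}\boldsymbol{\theta}\|_2^2$ and $\mathrm{MAD}(\boldsymbol{\theta})=\frac1n\|\mathbf{y}-\boldsymbol{\Phi}\boldsymbol{\theta}\|_1$. For sets $\mathcal{C}$ and $\mathcal{V}$ of positive semi-definite $d\times d$ and $n\times n$ matrices, let $\Theta^*$ be the set of all estimates $\widehat{\boldsymbol{\theta}}(\mathbf{C}^*,\mathbf{V}^* )$ with data-fitted weight matrices (as defined in the context). Then every element of $\Theta^*$ minimizes over $\boldsymbol{\theta}\in\mathbb{R}^d$ the following criterion: (a) if $\mathcal{C}=\{c\mathbf{I}: c\ge 0\}$ and $\mathcal{V}=\{v\mathbf{I}: v\ge 0\}$: $$\sqrt{\mathrm{MSD}(\boldsymbol{\theta})}+\lambda\|\boldsymbol{\theta}\|_2,\qquad \lambda=\sqrt{\operatorname{tr}\{\boldsymbol{\Sigma}\}/n};$$ (b) if $\mathcal{C}=\{c\mathbf{I}: c\ge 0\}$ and $\mathcal{V}$ is the set of all positive semi-definite diagonal matrices: $$\mathrm{MAD}(\boldsymbol{\theta})+\lambda\|\boldsymbol{\theta}\|_2,\qquad \lambda=\sqrt{\operatorname{tr}\{\boldsymbol{\Sigma}\}/n};$$ (c) if $\mathcal{C}$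 is the set of all positive semi-definite diagonal matrices and $\mathcal{V}=\{v\mathbf{I}: v\ge 0\}$: $$\sqrt{\mathrm{MSD}(\boldsymbol{\theta})}+\lambda\big\|\sqrt{\mathbf{I}\odot\boldsymbol{\Sigma}}\,\boldsymbol{\theta}\big\|_1,\qquad \lambda=\tfrac{1}{\sqrt n};$$ (d) if $\mathcal{C}$ and $\mathcal{V}$ are both the sets of all positive semi-definite diagonal matrices: $$\mathrm{MAD}(\boldsymbol{\theta})+\lambda\big\|\sqrt{\mathbf{I}\odot\boldsymbol{\Sigma}}\,\boldsymbol{\theta}\big\|_1,\qquad \lambda=\tfrac{1}{\sqrt n}.$$
   Context: $\mathbf{X}^\dagger$ is the Moore-Penrose pseudoinverse, $\mathcal{R}(\mathbf{M})$ the range of $\mathbf{M}$, $\odot$ the entrywise (Hadamard) product, so $\sqrt{\mathbf{I}\odot\boldsymbol{\Sigma}}$ is the diagonal matrix with entries $\sqrt{\Sigma_{ii}}$. For $\mathbf{W}\succeq\mathbf{0}$, $\|\mathbf{X}\|_{\mathbf{W}}=\sqrt{\operatorname{tr}\{\mathbf{X}^\top\mathbf{W}\mathbf{X}\}}$. For positive semi-definite $\mathbf{C}$ ($d\times d$) and $\mathbf{V}$ ($n\times n$) put $\mathbf{R}=\mathbf{R}(\mathbf{C},\mathbf{V})=\boldsymbol{\Phi}\mathbf{C}\boldsymbol{\Phi}^\top+\mathbf{V}$. When $\mathbf{y}\in\mathcal{R}(\mathbf{R})$, $\widehat{\boldsymbol{\theta}}(\mathbf{C},\mathbf{V})$ denotes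 the unique minimizer of $\|\mathbf{y}-\boldsymbol{\Phi}\boldsymbol{\theta}\|_{\mathbf{V}^\dagger}^2+\|\boldsymbol{\theta}\|_{\mathbf{C}^\dagger}^2$ over $\{\boldsymbol{\theta}:\mathbf{y}-\boldsymbol{\Phi}\boldsymbol{\theta}\in\mathcal{R}(\mathbf{V}),\ \boldsymbol{\theta}\in\mathcal{R}(\mathbf{C})\}$, namely $\widehat{\boldsymbol{\theta}}(\mathbf{C},\mathbf{V})=\mathbf{C}\boldsymbol{\Phi}^\top\mathbf{R}^\dagger\mathbf{y}$. The fitted weight matrices $(\mathbf{C}^*,\mathbf{V}^* )$ are any minimizers of $\|\mathbf{y}\mathbf{y}^\top-\mathbf{R}(\mathbf{C},\mathbf{V})\|^2_{\mathbf{R}(\mathbf{C},\mathbf{V})^\dagger}$ over $\mathbf{C}\in\mathcal{C}$, $\mathbf{V}\in\mathcal{V}$ subject to $\mathbf{y}\in\mathcal{R}(\mathbf{R}(\mathbf{C},\mathbf{V}))$, and $\Theta^*=\{\widehat{\boldsymbol{\theta}}(\mathbf{C}^*,\mathbf{V}^* )\}$ over all such minimizers. *)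

(* Defs.v *)
From mathcomp Require Import all_boot all_order all_algebra.
From mathcomp Require Import boolp classical_sets reals.
From mathcomp Require Import ring lra.

Set Implicit Arguments.
Unset Strict Implicit.
Unset Printing Implicit Defensive.

Import Order.TTheory GRing.Theory Num.Theory.

Local Open Scope classical_set_scope.
Local Open Scope ring_scope.

Section Definitions.
Variable R : realType.

Definition argmin (T : Type) (A : set T) (f : T -> R) : set T :=
  [set x | A x /\ forall z, A z -> f x <= f z].

(* The four Penrose equations; [mp_inverseP] and [mp_inverse_unique] below
   show that they determine exactly one matrix. *)
Definition penrose m n (A : 'M[R]_(m, n)) (X : 'M[R]_(n, m)) : Prop :=
  [/\ A *m X *m A = A, X *m A *m X = X,
      (A *m X)^T = A *m X & (X *m A)^T = X *m A].

Definition mp_inverse m n (A : 'M[R]_(m, n)) : 'M[R]_(n, m) :=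
  xget 0 [set X | penrose A X].

(* Column space, since vectors are columns here. *)
Definition mxrange m n (M : 'M[R]_(m, n)) : set 'cV[R]_m :=
  range (fun z : 'cV[R]_n => M *m z).

Definition psd n (A : 'M[R]_n) : Prop :=
  A^T = A /\ forall x : 'cV[R]_n, 0 <= (x^T *m A *m x) 0 0.

Definition wnorm n k (W : 'M[R]_n) (X : 'M[R]_(n, k)) : R :=
  Num.sqrt (\tr (X^T *m W *m X)).

Definition norm1 n (x : 'cV[R]_n) : R := \sum_i `|x i 0|.
Definition norm2 n (x : 'cV[R]_n) : R := Num.sqrt (\sum_i x i 0 ^+ 2).

Definition hadamard m n (A B : 'M[R]_(m, n)) : 'M[R]_(m, n) :=
  map2_mx (fun a b => a * b) A B.

(* Entrywise, hence the principal square root on nonnegative diagonal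
   matrices only. *)
Definition sqrt_mx m n (A : 'M[R]_(m, n)) : 'M[R]_(m, n) :=
  map_mx Num.sqrt A.

Definition nonneg_scalar_mx n : set 'M[R]_n :=
  [set c%:M | c in [set c : R | 0 <= c]].
Definition psd_diag_mx n : set 'M[R]_n :=
  [set A | is_diag_mx A /\ psd A].

Section Model.
Variables (n d : nat) (y : 'cV[R]_n) (Phi : 'M[R]_(n, d)).

Definition Rmx (C : 'M[R]_d) (V : 'M[R]_n) : 'M[R]_n :=
  Phi *m C *m Phi^T + V.

(* The set of minimizers. When C and V are positive semi-definite and y lies
   in the range of [Rmx Phi C V], it is the singleton of C Phi^T R^+ y: see
   [wls_estimatesE]. *)
Definition wls_estimates (C : 'M[R]_d) (V : 'M[R]_n) : set 'cV[R]_d :=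
  argmin [set theta | mxrange V (y - Phi *m theta) /\ mxrange C theta]
    (fun theta => wnorm (mp_inverse V) (y - Phi *m theta) ^+ 2
                  + wnorm (mp_inverse C) theta ^+ 2).

Definition fitted_weights (CC : set 'M[R]_d) (VV : set 'M[R]_n) :
    set ('M[R]_d * 'M[R]_n) :=
  argmin [set CV | [/\ CC CV.1, VV CV.2 & mxrange (Rmx CV.1 CV.2) y]]
    (fun CV => wnorm (mp_inverse (Rmx CV.1 CV.2))
                     (y *m y^T - Rmx CV.1 CV.2) ^+ 2).

Definition Theta_star (CC : set 'M[R]_d) (VV : set 'M[R]_n) : set 'cV[R]_d :=
  [set theta | exists C V,
     fitted_weights CC VV (C, V) /\ wls_estimates C V theta].

Definition Sigma : 'M[R]_d := n%:R^-1 *: (Phi^T *m Phi).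
Definition MSD (theta : 'cV[R]_d) : R :=
  n%:R^-1 * norm2 (y - Phi *m theta) ^+ 2.
Definition MAD (theta : 'cV[R]_d) : R :=
  n%:R^-1 * norm1 (y - Phi *m theta).

End Model.
End Definitions.

Section MoorePenrose.
Variable R : realType.

Lemma mp_inverse_unique m n (A : 'M[R]_(m, n)) X Y :
  penrose A X -> penrose A Y -> X = Y.
Proof.
move=> [x1 x2 x3 x4] [y1 y2 y3 y4].
have eAX : A *m X = A *m Y.
  by rewrite -x3 -{1}y1 -(mulmxA (A *m Y)) trmx_mul x3 y3 !mulmxA x1.
have eXA : X *m A = Y *m A.
  rewrite -x4 -{1}y1 !mulmxA -(mulmxA (X *m A)) trmx_mul x4 y4 -!mulmxA.
  by congr (Y *m _); rewrite !mulmxA x1.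
by rewrite -x2 -mulmxA eAX mulmxA eXA y2.
Qed.

Lemma gram_eq0 m (u : 'rV[R]_m) : u *m u^T = 0 -> u = 0.
Proof.
move=> /matrixP /(_ 0 0); rewrite !mxE => /eqP.
under eq_bigr do rewrite mxE.
rewrite psumr_eq0 => [/allP h|i _]; last by rewrite -expr2 sqr_ge0.
apply/rowP => i; rewrite mxE; apply/eqP.
by have := h i (mem_index_enum i); rewrite mulf_eq0 orbb.
Qed.

Lemma gram_unit m n (G : 'M[R]_(m, n)) :
  row_free G -> G *m G^T \in unitmx.
Proof.
move=> fG; rewrite -row_free_unit; apply: inj_row_free => v hv.
apply/eqP; rewrite -(mulmx_free_eq0 v fG); apply/eqP/gram_eq0.
by rewrite trmx_mul !mulmxA -(mulmxA v) hv mul0mx.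
Qed.

Lemma penrose_rank_factor m n r (B : 'M[R]_(m, r)) (G : 'M[R]_(r, n)) :
  row_full B -> row_free G ->
  penrose (B *m G)
    (G^T *m invmx (G *m G^T) *m invmx (B^T *m B) *m B^T).
Proof.
move=> fB fG; have uG : G *m G^T \in unitmx by exact: gram_unit.
have uB : B^T *m B \in unitmx.
  by rewrite -{2}(trmxK B); apply: gram_unit; rewrite /row_free mxrank_tr.
set g := invmx (G *m G^T); set b := invmx (B^T *m B).
have tg : g^T = g by rewrite /g trmx_inv trmx_mul trmxK.
have tb : b^T = b by rewrite /b trmx_inv trmx_mul trmxK.
have eAX : B *m G *m (G^T *m g *m b *m B^T) = B *m b *m B^T.
  by rewrite !mulmxA -(mulmxA B G) -(mulmxA B _ g) mulmxV // mulmx1.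
have eXA : (G^T *m g *m b *m B^T) *m (B *m G) = G^T *m g *m G.
  by rewrite !mulmxA -(mulmxA _ B^T B) -(mulmxA _ b) mulVmx // mulmx1.
split.
- by rewrite eAX !mulmxA -(mulmxA _ B^T B) -(mulmxA B b) mulVmx // mulmx1.
- by rewrite eXA !mulmxA -(mulmxA _ G G^T) -(mulmxA _ g (G *m _)) mulVmx
    // mulmx1.
- by rewrite eAX !trmx_mul trmxK tb mulmxA.
- by rewrite eXA !trmx_mul trmxK tg mulmxA.
Qed.

Lemma mp_inverseP m n (A : 'M[R]_(m, n)) : penrose A (mp_inverse A).
Proof.
apply: (xgetPex 0 (P := [set X | penrose A X])) => /=.
have := penrose_rank_factor (col_base_full A) (row_base_free A).
by rewrite mulmx_base => h; eexists; exact: h.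
Qed.

Lemma qform_add m (W : 'M[R]_m) (p q : 'cV[R]_m) : W^T = W ->
  ((p + q)^T *m W *m (p + q)) 0 0 = (p^T *m W *m p) 0 0
    + 2 * (p^T *m (W *m q)) 0 0 + (q^T *m W *m q) 0 0.
Proof.
move=> tW; have -> : (p + q)^T = p^T + q^T by rewrite linearD.
rewrite !mulmxDl !mulmxDr.
have -> : q^T *m W *m p = (p^T *m (W *m q))^T.
  by rewrite !trmx_mul trmxK tW.
rewrite -(mulmxA p^T W q); set a := p^T *m W *m p; set b := p^T *m _.
set c := q^T *m W *m q.
have -> : (a + b + (b^T + c)) 0 0 = a 0 0 + b 0 0 + (b 0 0 + c 0 0).
  by rewrite !(mxE, ord1).
ring.
Qed.

Lemma psd_ker n (A : 'M[R]_n) (x : 'cV[R]_n) :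
  psd A -> (x^T *m A *m x) 0 0 = 0 -> A *m x = 0.
Proof.
move=> [tA pA] hx; set z := A *m x.
have exz : x^T *m A = z^T by rewrite /z trmx_mul tA.
set q := (z^T *m A *m z) 0 0; set p := (z^T *m z) 0 0.
have p0 : 0 <= p.
  rewrite /p mxE; apply: sumr_ge0 => i _.
  by rewrite mxE -expr2 sqr_ge0.
have q0 : 0 <= q by exact: pA.
have key t : 0 <= 2 * t * p + t ^+ 2 * q.
  have := pA (x + t *: z); rewrite qform_add // hx mulmxA exz.
  have -> : (t *: z)^T = t *: z^T by rewrite linearZ.
  rewrite -!scalemxAl -!scalemxAr.
  have -> : (t *: (z^T *m z)) 0 0 = t * p by rewrite mxE.
  have -> : (t *: (t *: (z^T *m A *m z))) 0 0 = t * (t * q).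
    by rewrite mxE; congr (t * _); rewrite mxE.
  by rewrite add0r; have -> : 2 * (t * p) + t * (t * q)
    = 2 * t * p + t ^+ 2 * q by ring.
have pe : p = 0.
  have u : 0 < 1 + q by lra.
  set s := p / (1 + q).
  have es : p = s * (1 + q) by rewrite /s divfK // gt_eqF.
  have k : 0 <= - (s ^+ 2 * (2 + q)).
    have -> : - (s ^+ 2 * (2 + q)) = 2 * (- s) * p + (- s) ^+ 2 * q.
      by rewrite es; ring.
    exact: key.
  have s2 : s ^+ 2 = 0 by have := sqr_ge0 s; nra.
  by rewrite es; move/eqP: s2; rewrite sqrf_eq0 => /eqP ->; rewrite mul0r.
rewrite -(trmxK z) (_ : z^T = 0) ?trmx0 //; apply: gram_eq0.
by rewrite trmxK; apply/matrixP => i j; rewrite !ord1 [RHS]mxE -pe.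
Qed.

Lemma wnorm_mp n (W : 'M[R]_n) (a : 'cV[R]_n) :
  psd W -> wnorm (mp_inverse W) (W *m a) ^+ 2 = (a^T *m W *m a) 0 0.
Proof.
move=> [tW pW]; have [w1 _ _ _] := mp_inverseP W; rewrite /wnorm.
have -> : (W *m a)^T *m mp_inverse W *m (W *m a) = a^T *m W *m a.
  by rewrite trmx_mul tW -[in RHS]w1 !mulmxA.
by rewrite /mxtrace big_ord1 sqr_sqrtr.
Qed.

Lemma wls_estimatesE n d (y : 'cV[R]_n) (Phi : 'M[R]_(n, d)) C V :
  psd C -> psd V -> mxrange (Rmx Phi C V) y ->
  wls_estimates y Phi C V
    = [set C *m Phi^T *m mp_inverse (Rmx Phi C V) *m y].
Proof.
move=> hC hV [z _ ez]; set u := mp_inverse (Rmx Phi C V) *m y.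
have [tC pC] := hC; have [tV pV] := hV.
have eu : Phi *m C *m Phi^T *m u + V *m u = y.
  have [r1 _ _ _] := mp_inverseP (Rmx Phi C V).
  by rewrite -mulmxDl -/(Rmx Phi C V) /u -ez !mulmxA r1.
rewrite -mulmxA -/u; clearbody u; set th := C *m Phi^T *m u.
have eth : th = C *m (Phi^T *m u) by rewrite /th mulmxA.
have er : y - Phi *m th = V *m u.
  by rewrite -{1}eu /th !mulmxA addrC addKr.
pose J t := wnorm (mp_inverse V) (y - Phi *m t) ^+ 2
            + wnorm (mp_inverse C) t ^+ 2.
have feas : mxrange V (y - Phi *m th) /\ mxrange C th.
  by rewrite er eth; split; [exists u | exists (Phi^T *m u)].
have gap t : mxrange V (y - Phi *m t) /\ mxrange C t ->
    exists2 a, t = th + C *m a & J th + (a^T *m C *m a) 0 0 <= J t.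
  move=> [[b _ eb] [a _ ea]].
  exists (a - Phi^T *m u); first by rewrite mulmxBr ea eth addrC subrK.
  rewrite /J er {1}eth -eb -ea !wnorm_mp //.
  set a' := a - _; pose b' := b - u.
  have -> : a = Phi^T *m u + a' by rewrite /a' addrC subrK.
  have -> : b = u + b' by rewrite /b' addrC subrK.
  have e0 : V *m b' = - (Phi *m (C *m a')).
    rewrite /b' /a' !mulmxBr eb ea opprB -[in LHS]eu !mulmxA.
    by rewrite [_ + V *m u - _]addrAC addrK.
  clearbody a' b'.
  have e1 : (Phi^T *m u)^T *m (C *m a') = u^T *m (Phi *m (C *m a')).
    by rewrite trmx_mul trmxK -mulmxA.
  have e2 : (u^T *m (V *m b')) 0 0 = - (u^T *m (Phi *m (C *m a'))) 0 0.
    by rewrite e0 mulmxN [LHS]mxE.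
  rewrite !qform_add // e1 e2; have := pV b'; lra.
apply/seteqP; split => t /=.
- move=> [ft mt]; have [a et ja] := gap _ ft.
  have jt : J t <= J th by exact: mt.
  have a0 : (a^T *m C *m a) 0 0 = 0 by have := pC a; lra.
  by rewrite et (psd_ker hC a0) addr0.
- move=> ->; split => // s fs; rewrite -/(J s) -/(J th).
  by have [a _ ja] := gap _ fs; have := pC a; lra.
Qed.

End MoorePenrose.

(* Main.v *)
Require Import Defs.
From mathcomp Require Import all_boot all_order all_algebra.
From mathcomp Require Import boolp classical_sets reals.
From mathcomp Require Import ring lra.

(** Write s for the Euclidean norm of y and R for Phi C Phi^T + V.  When y lies
in the range of R, say y = R z, the fitting objective is, up to the constant
- 2 s^2, equal to s^2 z^T R z + tr R ([fit_objectiveE]).  Its first term is a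
partial minimum: z^T R z is the least value of a^T C a + b^T V b over all a, b
with Phi (C a) + V b = y ([qform_Rmx_le] gives the inequality), that is, with
theta = C a and residual V b; it is attained at the weighted least-squares
estimate, where a = Phi^T z and b = z.  Its second term splits as
tr (C Phi^T Phi) + tr V.

Fitting the weights and estimating theta is thus one joint minimization, and
the order can be exchanged: for fixed theta the weights C and V decouple, and
minimizing over them is the variational form of a norm,
    2 p(t) = inf of x^T A x + tr (A W) over A in the class and x with A x = t,
the predicate [trace_envelope] below.  By the inequality between arithmetic
and geometric means, p(t) is sqrt (tr W) times the Euclidean norm of t for the
multiples of the identity ([scalar_envelope]), and the l1 norm weighted by
sqrt (W i i) for diagonal matrices ([diag_envelope]).  With W = Phi^T Phi for C
and W = I for V, the estimates minimize p_V (y - Phi theta) + p_C theta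
([Theta_star_envelope]), which is n times the criterion in each of the four
cases.

The infimum need not be attained (for W = 0 it is approached by letting A grow),
and the A that attains it may be singular.  The argument therefore only uses
invertible weights that come within epsilon of it, for which the range
condition on y is automatic ([Rmx_unit]). *)

Set Implicit Arguments.
Unset Strict Implicit.
Unset Printing Implicit Defensive.

Import Order.TTheory GRing.Theory Num.Theory.

Local Open Scope classical_set_scope.
Local Open Scope ring_scope.

(** * Quadratic forms and the fitting objective *)

Section QuadraticForms.
Variable R : realType.

Definition qform n (A : 'M[R]_n) (x : 'cV[R]_n) : R := (x^T *m A *m x) 0 0.

Lemma qform_ge0 n (A : 'M[R]_n) x : psd A -> 0 <= qform A x.
Proof. by move=> [_]; apply. Qed.

Lemma qformZ n (A : 'M[R]_n) s (x : 'cV[R]_n) :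
  qform A (s *: x) = s ^+ 2 * qform A x.
Proof.
rewrite /qform -scalemxAr linearZ /= -!scalemxAl scalerA.
by rewrite mxE expr2.
Qed.

Lemma qform_diag n (a : 'rV[R]_n) (x : 'cV[R]_n) :
  qform (diag_mx a) x = \sum_i a 0 i * x i 0 ^+ 2.
Proof.
rewrite /qform -mulmxA mul_diag_mx mxE; apply: eq_bigr => i _.
by rewrite !mxE; ring.
Qed.

Lemma qform_conj n d (Phi : 'M[R]_(n, d)) (C : 'M[R]_d) (x : 'cV[R]_n) :
  qform (Phi *m C *m Phi^T) x = qform C (Phi^T *m x).
Proof. by rewrite /qform trmx_mul trmxK !mulmxA. Qed.

Lemma qformD n (A B : 'M[R]_n) x : qform (A + B) x = qform A x + qform B x.
Proof. by rewrite /qform mulmxDr mulmxDl mxE. Qed.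

Lemma mxtr_col_row n (x y : 'cV[R]_n) : \tr (x *m y^T) = (y^T *m x) 0 0.
Proof. by rewrite mxtrace_mulC /mxtrace big_ord1. Qed.

Lemma norm2_sqr n (x : 'cV[R]_n) : norm2 x ^+ 2 = \sum_i x i 0 ^+ 2.
Proof. by rewrite sqr_sqrtr // sumr_ge0 // => i _; apply: sqr_ge0. Qed.

Lemma norm2_ge0 n (x : 'cV[R]_n) : 0 <= norm2 x.
Proof. exact: sqrtr_ge0. Qed.

Lemma norm2_dot n (x : 'cV[R]_n) : (x^T *m x) 0 0 = norm2 x ^+ 2.
Proof. by rewrite norm2_sqr mxE; apply: eq_bigr => i _; rewrite mxE expr2. Qed.

Lemma norm2Z n (s : R) (x : 'cV[R]_n) : 0 <= s -> norm2 (s *: x) = s * norm2 x.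
Proof.
move=> s0; rewrite /norm2; under eq_bigr do rewrite mxE exprMn.
by rewrite -mulr_sumr sqrtrM ?sqr_ge0 // sqrtr_sqr ger0_norm.
Qed.

Lemma norm2_eq0 n (x : 'cV[R]_n) : norm2 x = 0 -> x = 0.
Proof.
move=> x0; apply: trmx_inj; rewrite trmx0; apply: gram_eq0; rewrite trmxK.
by apply/matrixP => i j; rewrite !ord1 norm2_dot x0 expr0n mxE.
Qed.

Lemma psd_diag n (a : 'rV[R]_n) : (forall i, 0 <= a 0 i) -> psd (diag_mx a).
Proof.
move=> a0; split; first exact: tr_diag_mx.
move=> x; rewrite -/(qform _ x) qform_diag; apply: sumr_ge0 => i _.
by rewrite mulr_ge0 ?sqr_ge0.
Qed.

Lemma psd_diag_entry_ge0 n (a : 'rV[R]_n) i : psd (diag_mx a) -> 0 <= a 0 i.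
Proof.
move=> [_ /(_ (delta_mx i 0))]; rewrite -/(qform _ _) qform_diag.
rewrite (bigD1 i) //= big1 => [|j /negbTE ji]; last first.
  by rewrite mxE ji expr0n mulr0.
by rewrite mxE !eqxx expr1n mulr1 addr0.
Qed.

Lemma psd_Rmx n d (Phi : 'M[R]_(n, d)) C V :
  psd C -> psd V -> psd (Rmx Phi C V).
Proof.
move=> pC pV; split.
  have [[tC _] [tV _]] := (pC, pV).
  by rewrite /Rmx linearD /= !trmx_mul trmxK tC tV mulmxA.
by move=> x; rewrite -/(qform _ x) qformD qform_conj addr_ge0 ?qform_ge0.
Qed.

(** An invertible V makes V, hence R, positive definite. *)
Lemma Rmx_unit n d (Phi : 'M[R]_(n, d)) C V :
  psd C -> psd V -> V \in unitmx -> Rmx Phi C V \in unitmx.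
Proof.
move=> pC pV uV; have [tR _] := psd_Rmx Phi pC pV.
rewrite -row_free_unit; apply: inj_row_free => v hv.
have Rv : Rmx Phi C V *m v^T = 0 by rewrite -tR -trmx_mul hv trmx0.
have : qform (Rmx Phi C V) v^T = 0 by rewrite /qform -mulmxA Rv mulmx0 mxE.
rewrite qformD qform_conj => q0.
have Vv0 : qform V v^T = 0.
  by have := qform_ge0 (Phi^T *m v^T) pC; have := qform_ge0 v^T pV; lra.
have : V *m v^T = 0 by exact: psd_ker.
move/(congr1 (mulmx (invmx V))); rewrite mulmxA mulVmx // mul1mx mulmx0.
by move/(congr1 trmx); rewrite trmxK trmx0.
Qed.

Lemma mxtr_Rmx n d (Phi : 'M[R]_(n, d)) C V :
  \tr (Rmx Phi C V) = \tr (C *m (Phi^T *m Phi)) + \tr (V *m 1%:M).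
Proof. by rewrite linearD /= -mulmxA mxtrace_mulC mulmx1 !mulmxA. Qed.

(** With y = M z, the matrix y y^T - M factors as M D for D = z y^T - I, so
M M^+ M = M removes the pseudoinverse and leaves tr (D^T M D). *)
Lemma fit_objectiveE n (y z : 'cV[R]_n) (M : 'M[R]_n) :
  psd M -> M *m z = y ->
  wnorm (mp_inverse M) (y *m y^T - M) ^+ 2
    = norm2 y ^+ 2 * qform M z - 2 * norm2 y ^+ 2 + \tr M.
Proof.
move=> [tM pM] Mz; have [m1 _ _ _] := mp_inverseP M.
set D := z *m y^T - 1%:M.
have -> : y *m y^T - M = M *m D by rewrite /D mulmxBr mulmx1 mulmxA Mz.
rewrite /wnorm trmx_mul tM.
have -> : D^T *m M *m mp_inverse M *m (M *m D) = D^T *m M *m D.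
  by rewrite -[in RHS]m1 !mulmxA.
rewrite sqr_sqrtr; last first.
  apply: sumr_ge0 => i _.
  suff -> : (D^T *m M *m D) i i = qform M (col i D) by exact: qform_ge0.
  rewrite /qform tr_col -row_mul [LHS]mxE [RHS]mxE; apply: eq_bigr => j _.
  by rewrite [col _ _ _ _]mxE [row _ _ _ _]mxE.
have zM : z^T *m M = y^T by rewrite -Mz trmx_mul tM.
have -> : D^T *m M *m D
    = qform M z *: (y *m y^T) - (y *m y^T) - (y *m y^T) + M.
  have -> : D^T = y *m z^T - 1%:M.
    by rewrite /D linearB /= trmx_mul trmxK tr_scalar_mx.
  rewrite mulmxBl mul1mx -(mulmxA y) zM /D.
  rewrite mulmxBr mulmx1 mulmxBl (mulmxA M) Mz opprB addrA.
  have -> : y *m y^T *m (z *m y^T) = qform M z *: (y *m y^T).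
    rewrite -mulmxA (mulmxA y^T) -{1}zM (mx11_scalar (z^T *m M *m z)).
    by rewrite mul_scalar_mx scalemxAr.
  by rewrite addrAC.
rewrite linearD /= !linearB /= linearZ /= mxtr_col_row norm2_dot.
by ring.
Qed.

(** The value of the fit at z is z^T V b + (Phi^T z)^T C a; each of the two
pairings is at most the half-sum of the quadratic forms at its arguments. *)
Lemma qform_Rmx_le n d (Phi : 'M[R]_(n, d)) C V (z b : 'cV[R]_n) (a : 'cV[R]_d) :
  psd C -> psd V -> Rmx Phi C V *m z = V *m b + Phi *m (C *m a) ->
  qform (Rmx Phi C V) z <= qform C a + qform V b.
Proof.
move=> pC pV Rz.
have : qform (Rmx Phi C V) z
    = (z^T *m (V *m b)) 0 0 + ((Phi^T *m z)^T *m (C *m a)) 0 0.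
  by rewrite /qform -mulmxA Rz mulmxDr mxE trmx_mul trmxK !mulmxA.
rewrite qformD qform_conj.
have gap m (A : 'M[R]_m) p q : psd A ->
    2 * (p^T *m (A *m q)) 0 0 <= qform A p + qform A q.
  move=> pA; have := qform_ge0 (p - q) pA.
  rewrite {1}/qform qform_add ?pA.1 // -/(qform A p) -/(qform A (- q)).
  by rewrite -scaleN1r qformZ -!scalemxAr [X in _ + 2 * X]mxE; lra.
have := gap _ _ (Phi^T *m z) a pC; have := gap _ _ z b pV; lra.
Qed.

End QuadraticForms.

(** * Norms as infima over weight matrices *)

Section TraceEnvelope.
Variable R : realType.

(** Apart from homogeneity and sign, this says that 2 p(t) is the infimum of
x^T A x + tr (A W) over A in AA and x with A x = t.  Parametrizing by x rather
than by t and A^+ keeps pseudoinverses and range conditions out of the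
definition; the invertible A of the last clause keep the range condition of
the fit satisfied. *)
Record trace_envelope m (AA : set 'M[R]_m) (W : 'M[R]_m)
    (p : 'cV[R]_m -> R) : Prop := TraceEnvelope {
  envelope_psd : forall A, AA A -> psd A;
  envelope_ge0 : forall t, 0 <= p t;
  envelope_scale : forall s t, 0 <= s -> p (s *: t) = s * p t;
  envelope_lower : forall A x, AA A ->
    2 * p (A *m x) <= qform A x + \tr (A *m W);
  envelope_approx : forall t e, 0 < e ->
    exists A x, [/\ AA A, A \in unitmx, A *m x = t
      & qform A x + \tr (A *m W) <= 2 * p t + e]
}.

(** For w > 0 the minimizer v = a / sqrt w is perturbed so as to be positive
also when a = 0. *)
Lemma amgm_approx (a w e : R) : 0 <= a -> 0 <= w -> 0 < e ->
  exists2 v, 0 < v & a ^+ 2 / v + v * w <= 2 * (Num.sqrt w * a) + e.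
Proof.
move=> a0 w0 e0; rewrite -{1}(sqr_sqrtr w0).
have : 0 <= Num.sqrt w by exact: sqrtr_ge0.
set k := Num.sqrt w; rewrite le_eqVlt => /predU1P[<-|k0].
  (* w = 0: the term v * w vanishes, so v can be taken large enough to bring
     a ^+ 2 / v below e *)
  have v0 : 0 < a ^+ 2 / e + 1 by rewrite ltr_wpDl // divr_ge0 ?sqr_ge0 // ltW.
  exists (a ^+ 2 / e + 1) => //.
  rewrite expr0n mulr0 addr0 mul0r mulr0 add0r ler_pdivrMr // mulrDr mulr1.
  by rewrite mulrC divfK ?gt_eqF // lerDl ltW.
have d0 : 0 < e / k by rewrite divr_gt0.
have ae : 0 < a + e / k by rewrite ltr_wpDl.
exists ((a + e / k) / k); first by rewrite divr_gt0.
have -> : (a + e / k) / k * k ^+ 2 = k * a + e by field; rewrite gt_eqF.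
have : a ^+ 2 / ((a + e / k) / k) <= k * a.
  rewrite ler_pdivrMr ?divr_gt0 //.
  have -> : k * a * ((a + e / k) / k) = a ^+ 2 + a * (e / k).
    by field; rewrite gt_eqF.
  by rewrite lerDl mulr_ge0 // ltW.
by lra.
Qed.

Lemma amgm (x k : R) : 2 * (k * x) <= x ^+ 2 + k ^+ 2.
Proof. by have := sqr_ge0 (x - k); rewrite sqrrB -subr_ge0; lra. Qed.

Lemma scalar_envelope m (W : 'M[R]_m) : 0 <= \tr W ->
  trace_envelope (@nonneg_scalar_mx R m) W
    (fun t => Num.sqrt (\tr W) * norm2 t).
Proof.
have qs c (x : 'cV[R]_m) : qform c%:M x = c * norm2 x ^+ 2.
  by rewrite -norm2_dot /qform mul_mx_scalar -scalemxAl mxE.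
move=> W0; split.
- move=> A [c /= c0 <-]; split; first exact: tr_scalar_mx.
  by move=> x; rewrite -/(qform _ _) qs mulr_ge0 ?sqr_ge0.
- by move=> t; rewrite mulr_ge0 ?sqrtr_ge0.
- by move=> s t s0; rewrite norm2Z // mulrCA.
- move=> A x [c /= c0 <-]; rewrite qs !mul_scalar_mx mxtraceZ norm2Z //.
  have := amgm (norm2 x) (Num.sqrt (\tr W)).
  move/(ler_wpM2l c0); rewrite (sqr_sqrtr W0); lra.
- move=> t e e0; have [v v0 hv] := amgm_approx (norm2_ge0 t) W0 e0.
  exists v%:M, (v^-1 *: t); split.
  + by exists v => //=; apply: ltW.
  + by rewrite unitmxE det_scalar unitfE lt0r_neq0 // exprn_gt0.
  + by rewrite mul_scalar_mx scalerA divff ?scale1r // lt0r_neq0.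
  + rewrite qs mul_scalar_mx mxtraceZ norm2Z ?invr_ge0 ?(ltW v0) //.
    suff -> : v * (v^-1 * norm2 t) ^+ 2 = norm2 t ^+ 2 / v by exact: hv.
    by field; rewrite gt_eqF.
Qed.

(** Both terms of the envelope are sums over the diagonal, so the minimization
splits into one scalar problem per coordinate. *)
Lemma diag_envelope m (W : 'M[R]_m) : (forall i, 0 <= W i i) ->
  trace_envelope (@psd_diag_mx R m) W
    (fun t => \sum_i Num.sqrt (W i i) * `|t i 0|).
Proof.
have trd (a : 'rV[R]_m) : \tr (diag_mx a *m W) = \sum_i a 0 i * W i i.
  by rewrite mul_diag_mx; apply: eq_bigr => i _; rewrite mxE.
move=> W0; split.
- by move=> A [].
- by move=> t; apply: sumr_ge0 => i _; rewrite mulr_ge0 ?sqrtr_ge0.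
- move=> s t s0; rewrite mulr_sumr; apply: eq_bigr => i _.
  by rewrite mxE normrM ger0_norm // mulrCA.
- move=> A x [/is_diag_mxP dA pA].
  have {dA} [a ea] : exists a, A = diag_mx a.
    exists (\row_i A i i); apply/matrixP => i j; rewrite !mxE.
    have [->//|ij] := eqVneq i j; by rewrite dA.
  move: pA; rewrite ea => pA; rewrite qform_diag trd -big_split mulr_sumr /=.
  apply: ler_sum => i _; have a0 := psd_diag_entry_ge0 i pA.
  rewrite mul_diag_mx mxE normrM (ger0_norm a0).
  have := amgm `|x i 0| (Num.sqrt (W i i)).
  move/(ler_wpM2l a0); rewrite (sqr_sqrtr (W0 i)) real_normK ?num_real //; lra.
- (* e / m.+1 per coordinate, since m may be 0 *)
  move=> t e e0; have e'0 : 0 < e / m.+1%:R by rewrite divr_gt0 ?ltr0Sn.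
  have /fin_all_exists[v hv] : forall i, exists v, 0 < v /\
      `|t i 0| ^+ 2 / v + v * W i i
        <= 2 * (Num.sqrt (W i i) * `|t i 0|) + e / m.+1%:R.
    move=> i; have [v v0 hv] := amgm_approx (normr_ge0 (t i 0)) (W0 i) e'0.
    by exists v.
  exists (diag_mx (\row_i v i)), (\col_i (t i 0 / v i)); split.
  + split; first exact: diag_mx_is_diag.
    by apply: psd_diag => i; rewrite mxE ltW // (hv i).1.
  + rewrite unitmxE det_diag unitfE; apply/prodf_neq0 => i _.
    by rewrite mxE gt_eqF // (hv i).1.
  + apply/colP => i; rewrite mul_diag_mx !mxE mulrC divfK //.
    by rewrite gt_eqF // (hv i).1.
  + rewrite qform_diag trd -big_split mulr_sumr /=.
    apply: (@le_trans _ _ (\sum_i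
        (2 * (Num.sqrt (W i i) * `|t i 0|) + e / m.+1%:R))).
      apply: ler_sum => i _; have [v0 {}hv] := hv i; rewrite !mxE.
      suff -> : v i * (t i 0 / v i) ^+ 2 = `|t i 0| ^+ 2 / v i by [].
      by rewrite real_normK ?num_real //; field; rewrite gt_eqF.
    rewrite big_split /= lerD2l sumr_const card_ord -[leLHS]mulr_natr.
    rewrite mulrAC ler_pdivrMr ?ltr0Sn // ler_pM2l // ler_nat //.
Qed.

End TraceEnvelope.

(** * Exchanging the two minimizations *)

Section Fitting.
Variable R : realType.

(** Write p theta for p_V (y - Phi theta) + p_C theta, s for the norm of y, and
F for s^2 z^T R z + tr R with R z = y.  If C, V are fitted weights and R u = y,
the estimate is th = C Phi^T u, with residual V u, and the lower envelope bounds
at s Phi^T u and s u add up to 2 s p(th) <= F(C, V).  This is at most F(C', V')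
for weights C', V' nearly optimal for s t and s (y - Phi t), which
[qform_Rmx_le] bounds by 2 s p(t) + e for any competitor t. *)
Lemma Theta_star_envelope n d (y : 'cV[R]_n) (Phi : 'M[R]_(n, d))
    CC VV pC pV :
  trace_envelope CC (Phi^T *m Phi) pC -> trace_envelope VV 1%:M pV ->
  Theta_star y Phi CC VV
    `<=` argmin setT (fun theta => pV (y - Phi *m theta) + pC theta).
Proof.
move=> eC eV th [C [V [[/= [hC hV ry] fit] est]]].
have psdC := envelope_psd eC hC; have psdV := envelope_psd eV hV.
have psdR := psd_Rmx Phi psdC psdV.
move: est; rewrite wls_estimatesE //= -mulmxA.
have Ru : Rmx Phi C V *m (mp_inverse (Rmx Phi C V) *m y) = y.
  have [r1 _ _ _] := mp_inverseP (Rmx Phi C V).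
  by case: ry => z _ <-; rewrite !mulmxA r1.
set u := mp_inverse _ *m y in Ru * => eth; split=> // t _.
have s0 : 0 <= norm2 y by exact: norm2_ge0.
have [y0|sn0] := eqVneq (norm2 y) 0.
  (* scaling by the norm of y loses all information when y = 0, but then the
     estimate is 0 *)
  have -> : th = 0 by rewrite eth /u (norm2_eq0 y0) !mulmx0.
  have p0 m AA W (p : 'cV[R]_m -> R) : trace_envelope AA W p -> p 0 = 0.
    by move=> e; rewrite -(scale0r 0) (envelope_scale e) // mul0r.
  rewrite mulmx0 subr0 (norm2_eq0 y0) (p0 _ _ _ _ eC) (p0 _ _ _ _ eV) addr0.
  by rewrite addr_ge0 ?(envelope_ge0 eC) ?(envelope_ge0 eV).
have s_gt0 : 0 < norm2 y by rewrite lt_def sn0.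
rewrite -(ler_pM2l s_gt0) -(ler_pM2l (ltr0n R 2)); apply/ler_addgt0Pr => e e0.
have e20 : 0 < e / 2 by rewrite divr_gt0.
rewrite !mulrDr -!(envelope_scale eC _ s0) -!(envelope_scale eV _ s0).
have res : y - Phi *m th = V *m u.
  by rewrite -{1}Ru eth /Rmx mulmxDl !mulmxA addrC addKr.
have := envelope_lower eV (norm2 y *: u) hV.
have := envelope_lower eC (norm2 y *: (Phi^T *m u)) hC.
rewrite -!scalemxAr -res (mulmxA C Phi^T u) -eth !qformZ.
have [C' [a [hC' _ Ca leC]]] := envelope_approx eC (norm2 y *: t) e20.
have [V' [b [hV' uV Vb leV]]] :=
  envelope_approx eV (norm2 y *: (y - Phi *m t)) e20.
have psdC' := envelope_psd eC hC'; have psdV' := envelope_psd eV hV'.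
have uR := Rmx_unit Phi psdC' psdV' uV.
set z := invmx (Rmx Phi C' V') *m y.
have Rz : Rmx Phi C' V' *m z = y by rewrite mulmxA mulmxV // mul1mx.
have ry' : mxrange (Rmx Phi C' V') y by exists z.
have := fit (C', V') (And3 hC' hV' ry') => /=.
rewrite (fit_objectiveE psdR Ru) (fit_objectiveE (psd_Rmx Phi psdC' psdV') Rz).
rewrite !mxtr_Rmx qformD qform_conj mulrDr.
have := @qform_Rmx_le R n d Phi C' V' (norm2 y *: z) b a psdC' psdV'.
rewrite -scalemxAr Rz Vb Ca -scalemxAr -scalerDr subrK => /(_ erefl).
by rewrite qformZ; lra.
Qed.

Lemma argmin_rescale T (A : set T) (f g : T -> R) k :
  0 <= k -> (forall x, f x = k * g x) -> argmin A g `<=` argmin A f.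
Proof.
move=> k0 fg x [Ax gx]; split=> // z Az.
by rewrite !fg ler_wpM2l // gx.
Qed.

Lemma gram_diag_ge0 n d (Phi : 'M[R]_(n, d)) i : 0 <= (Phi^T *m Phi) i i.
Proof. by rewrite mxE sumr_ge0 // => j _; rewrite mxE -expr2 sqr_ge0. Qed.

Lemma sqrt_nat_inv n : (0 < n)%N ->
  Num.sqrt (n%:R^-1) = n%:R^-1 * Num.sqrt n%:R :> R.
Proof.
move=> n0; have s0 : 0 < Num.sqrt n%:R :> R by rewrite sqrtr_gt0 ltr0n.
rewrite sqrtrV ?ler0n // -{2}(@sqr_sqrtr R n%:R) ?ler0n //.
by field; rewrite gt_eqF.
Qed.

Lemma sqrt_MSD n d (y : 'cV[R]_n) (Phi : 'M[R]_(n, d)) t : (0 < n)%N ->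
  Num.sqrt (MSD y Phi t)
    = n%:R^-1 * (Num.sqrt (\tr (1%:M : 'M[R]_n)) * norm2 (y - Phi *m t)).
Proof.
move=> n0; rewrite /MSD sqrtrM ?invr_ge0 ?ler0n // sqrtr_sqr.
by rewrite ger0_norm ?norm2_ge0 // sqrt_nat_inv // mxtrace1 mulrA.
Qed.

Lemma MAD_sum n d (y : 'cV[R]_n) (Phi : 'M[R]_(n, d)) t :
  MAD y Phi t = n%:R^-1 * \sum_i Num.sqrt ((1%:M : 'M[R]_n) i i)
                                  * `|(y - Phi *m t) i 0|.
Proof.
congr (_ * _); apply: eq_bigr => i _.
by rewrite [1%:M i i]mxE eqxx sqrtr1 mul1r.
Qed.

Lemma sqrt_trace_Sigma n d (Phi : 'M[R]_(n, d)) :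
  Num.sqrt (\tr (Sigma Phi) / n%:R)
    = n%:R^-1 * Num.sqrt (\tr (Phi^T *m Phi)).
Proof.
rewrite /Sigma mxtraceZ mulrAC -expr2 sqrtrM ?sqr_ge0 // sqrtr_sqr.
by rewrite ger0_norm // invr_ge0 ler0n.
Qed.

(** The two factors 1 / sqrt n, one from lambda and one from Sigma, combine. *)
Lemma weighted_norm1_Sigma n d (Phi : 'M[R]_(n, d)) (t : 'cV[R]_d) :
  (0 < n)%N ->
  1 / Num.sqrt n%:R * norm1 (sqrt_mx (hadamard 1%:M (Sigma Phi)) *m t)
    = n%:R^-1 * \sum_i Num.sqrt ((Phi^T *m Phi) i i) * `|t i 0|.
Proof.
move=> n0.
have -> : sqrt_mx (hadamard 1%:M (Sigma Phi))
    = diag_mx (\row_i (Num.sqrt n%:R^-1 * Num.sqrt ((Phi^T *m Phi) i i))).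
  apply/matrixP => i j; rewrite !mxE.
  have [->|ij] := eqVneq i j; last by rewrite mulr0n mul0r sqrtr0.
  by rewrite mul1r !mulr1n sqrtrM // invr_ge0 ler0n.
rewrite /norm1 !mulr_sumr; apply: eq_bigr => i _.
rewrite mul_diag_mx [X in `|X|]mxE [(\row__ _) 0 i]mxE.
rewrite normrM ger0_norm ?mulr_ge0 ?sqrtr_ge0 // !mulrA.
congr (_ * _ * _).
by rewrite sqrtrV ?ler0n // div1r -invfM -expr2 sqr_sqrtr ?ler0n.
Qed.

End Fitting.

Theorem mainTheorem5 (R : realType) (n d : nat) (n_gt0 : (0 < n)%N)
    (y : 'cV[R]_n) (Phi : 'M[R]_(n, d)) :
  [/\ Theta_star y Phi (@nonneg_scalar_mx R d) (@nonneg_scalar_mx R n) `<=`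
        argmin setT (fun theta : 'cV[R]_d =>
          Num.sqrt (MSD y Phi theta)
          + Num.sqrt (\tr (Sigma Phi) / n%:R) * norm2 theta),
      Theta_star y Phi (@nonneg_scalar_mx R d) (@psd_diag_mx R n) `<=`
        argmin setT (fun theta : 'cV[R]_d =>
          MAD y Phi theta
          + Num.sqrt (\tr (Sigma Phi) / n%:R) * norm2 theta),
      Theta_star y Phi (@psd_diag_mx R d) (@nonneg_scalar_mx R n) `<=`
        argmin setT (fun theta : 'cV[R]_d =>
          Num.sqrt (MSD y Phi theta)
          + 1 / Num.sqrt n%:R
            * norm1 (sqrt_mx (hadamard 1%:M (Sigma Phi)) *m theta))
    & Theta_star y Phi (@psd_diag_mx R d) (@psd_diag_mx R n) `<=`
        argmin setT (fun theta : 'cV[R]_d =>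
          MAD y Phi theta
          + 1 / Num.sqrt n%:R
            * norm1 (sqrt_mx (hadamard 1%:M (Sigma Phi)) *m theta))].
Proof.
have n0 : 0 <= n%:R^-1 :> R by rewrite invr_ge0 ler0n.
have g0 := gram_diag_ge0 Phi.
have Cs : trace_envelope _ (Phi^T *m Phi) _ :=
  scalar_envelope (sumr_ge0 _ (fun i _ => g0 i)).
have Cd := diag_envelope g0.
have i0 i : 0 <= (1%:M : 'M[R]_n) i i by rewrite mxE eqxx.
have Vs : trace_envelope _ (1%:M : 'M[R]_n) _ :=
  scalar_envelope (sumr_ge0 _ (fun i _ => i0 i)).
have Vd := diag_envelope i0.
split.
- apply: subset_trans (Theta_star_envelope Cs Vs) _.
  apply: argmin_rescale n0 _ => t.
  by rewrite sqrt_MSD // sqrt_trace_Sigma -mulrA -mulrDr.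
- apply: subset_trans (Theta_star_envelope Cs Vd) _.
  apply: argmin_rescale n0 _ => t.
  by rewrite MAD_sum sqrt_trace_Sigma -mulrA -mulrDr.
- apply: subset_trans (Theta_star_envelope Cd Vs) _.
  apply: argmin_rescale n0 _ => t.
  by rewrite sqrt_MSD // weighted_norm1_Sigma // -mulrDr.
- apply: subset_trans (Theta_star_envelope Cd Vd) _.
  apply: argmin_rescale n0 _ => t.
  by rewrite MAD_sum weighted_norm1_Sigma // -mulrDr.
Qed.
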